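(* Let $V_0\subseteq V_1$ be models of set theory, let $(\mathcal{M}_0,f_0,\mathcal{W}_0)\in V_0$ be a generalized dynamical system (in the sense of $V_0$), and let $(\mathcal{M}_1,f_1,\mathcal{W}_1)\in V_1$ be its relativization to $V_1$ for being a generalized dynamical system. If $(\mathcal{M}_0,f_0)$ has a fixed point, then so does $(\mathcal{M}_1,f_1)$.
   Context: **Models of set theory.** We work in a background model of ZFC; a *model of set theory* is a transitive subclass $V$ of it with $(V,\in)\models \mathrm{ZFC}$. **Distance monoids.** A *distance monoid* (commutative positive linear ordered monoid) is $\mathcal{W}=\langle W,+,0,\leq\rangle$ where $\langle W,+,0\rangle$ is a commutative monoid, $\leq$ is a linear order with minimal element $0$, $a\leq b$ implies $c+a\leq c+b$ and $a+c\leq b+c$, and $b+\bigwedge A=\bigwedge_{a\in A}(a+b)$ for all $b\in W$ and $A\subseteq W$ (whose infimum exists). Write $W^+=W\setminus\{0\}$. $\mathcal{W}$ is *continuous at $0$* if $0=\bigwedge_{a,b\in W^+}(a+b)$; *complete* if $\langle W,\leq\rangle$ is a complete linear order; *continuous* if complete and continuous at $0$. The *completion* $\overline{\mathcal{W}}$ of $\mathcal{W}$ is the distance monoid whose order is the Dedekind–MacNeille completion of $\langle W,\leq\rangle$ and whose addition extends that of $\mathcal W$; explicitly $a+b=\bigwedge\{a'+b' : a',b'\in W,\ a'\geq a,\ b'\geq b\}$. **$\mathcal{W}$-metric spaces.** A *$\mathcal{W}$-metric space* is $\mathcal{M}=(M,d)$ with $d:M\times M\to W$ (not assumed symmetric)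 such that $\max(d(x,y),d(y,x))=0$ iff $x=y$, and $d(x,z)\leq d(x,y)+d(y,z)$. A map $f$ is *non-expanding* if $d(f(x),f(y))\leq d(x,y)$ for all $x,y$. **Cauchy completeness.** A *Cauchy sequence* on $\mathcal{M}$ is a map $p:A\to M$, $A\subseteq W^+$ with $\bigwedge_{a,b\in A}(a+b)=0$, such that $d(p(a),p(b))\leq a+b$ for all $a,b\in A$; $\mathrm{dom}(p)=A$. It *converges* to $x\in M$ if $\bigvee_{a\in W^+}\bigwedge_{b\leq a,\,b\in \mathrm{dom}(p)}d(x,p(b))=0$ and $\bigvee_{a\in W^+}\bigwedge_{b\leq a,\,b\in \mathrm{dom}(p)}d(p(b),x)=0$. $(\mathcal{M},\mathcal{W})$ is *Cauchy complete* if $\mathcal{W}$ is complete and every Cauchy sequence on $\mathcal M$ converges to an element of $M$. (If $\mathcal{W}$ is not continuous at $0$ there are no Cauchy sequences.) **Cauchy completion.** If $\mathcal{W}$ is continuous, for Cauchy sequences $p,q$ put $d(p,q)=\bigvee_{c\in W^+}\bigwedge\{d(p(a),q(b)) : a\in \mathrm{dom}(p), b\in\mathrm{dom}(q), a,b\leq c\}$, and $p\equiv q$ iff $d(p,q)=d(q,p)=0$. The Cauchy completion $\mathbf{cc}(\mathcal{M})$ is the space of $\equiv$-classes with the induced distance, where each $x\in M$ is identified with the class of the constant sequence $\widehat{x}:W^+\to M$ with value $x$, so that $M\subseteq \mathbf{cc}(M)$. If $\mathcal{W}$ is not continuous at $0$, $\mathbf{cc}(\mathcal{M})$ is $\mathcal{M}$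 regarded as a $\overline{\mathcal{W}}$-metric space. In general the Cauchy completion of $(\mathcal{M},\mathcal{W})$ is $(\mathbf{cc}(\mathcal{M}),\overline{\mathcal{W}})$, where for $\mathcal{W}$ continuous at $0$ one first regards $\mathcal M$ as a $\overline{\mathcal{W}}$-metric space. A non-expanding $f:\mathcal{M}\to\mathcal{M}$ has a unique non-expanding extension $\mathbf{cc}(f):\mathbf{cc}(\mathcal{M})\to\mathbf{cc}(\mathcal{M})$. **Dynamical systems.** For $\mathcal{W}$ a complete distance monoid, a *$\mathcal{W}$-dynamical system* is $(\mathcal{M},f)$ with $\mathcal{M}$ a Cauchy complete $\mathcal{W}$-metric space and $f:\mathcal{M}\to\mathcal{M}$ non-expanding; then $(\mathcal{M},f,\mathcal{W})$ is a *generalized dynamical system*. It *has a fixed point* if $f(x)=x$ for some $x\in M$. **Relativization.** For models of set theory $V_0\subseteq V_1$ and a generalized dynamical system $(\mathcal{M},f,\mathcal{W})\in V_0$ (in the sense of $V_0$), its *relativization to $V_1$ for being a generalized dynamical system* is $(\mathbf{cc}(\mathcal{M}),\mathbf{cc}(f),\overline{\mathcal{W}})^{V_1}$, i.e. these completions computed in $V_1$. *)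

(* Defs.v *)
Set Implicit Arguments.
Unset Strict Implicit.
Unset Printing Implicit Defensive.

(** The background universe is a type [U] with a binary relation; Leibniz
    equality on [U] interprets the equality symbol of set theory. *)
Record universe := Universe { sets :> Type; mem : sets -> sets -> Prop }.

Declare Scope set_scope.
Open Scope set_scope.
Notation "x ∈ y" := (mem x y) (at level 70, no associativity) : set_scope.

(** Quantifiers relativized to a class [V].  Below, a notion taking [V] as its
    first argument is the relativization to [V] of the usual set-theoretic
    notion: all its quantifiers range over elements of [V]. *)
Definition all_in (U : universe) (V P : U -> Prop) := forall x : U, V x -> P x.
Definition ex_in (U : universe) (V P : U -> Prop) := exists x : U, V x /\ P x.
Arguments all_in U V P /.
Arguments ex_in U V P /.

Notation "∀[ V ] x .. y , P" :=
  (all_in V (fun x => .. (all_in V (fun y => P)) ..))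
  (at level 200, x binder, y binder, right associativity,
   format "'[  ' ∀[ V ]  x  ..  y ,  '/' P ']'") : set_scope.
Notation "∃[ V ] x .. y , P" :=
  (ex_in V (fun x => .. (ex_in V (fun y => P)) ..))
  (at level 200, x binder, y binder, right associativity,
   format "'[  ' ∃[ V ]  x  ..  y ,  '/' P ']'") : set_scope.

(** ** First-order formulas of set theory, in de Bruijn notation *)

Inductive formula :=
| Fmem (i j : nat)
| Feq (i j : nat)
| Fnot (A : formula)
| Fand (A B : formula)
| Fall (A : formula).

Definition scons (T : Type) (x : T) (e : nat -> T) : nat -> T :=
  fun n => match n with 0 => x | S m => e m end.

Fixpoint sat (U : universe) (V : U -> Prop) (e : nat -> U) (A : formula) : Prop :=
  match A with
  | Fmem i j => e i ∈ e j
  | Feq i j => e i = e j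
  | Fnot B => ~ sat V e B
  | Fand B C => sat V e B /\ sat V e C
  | Fall B => ∀[V] x, sat V (scons x e) B
  end.

Section SetTheory.

Variable U : universe.
Implicit Types (V : U -> Prop) (w x y z a b c p q r X Y Z M : U).

Record ZFC V : Prop := {
  zf_extensionality : ∀[V] x y, (∀[V] z, z ∈ x <-> z ∈ y) -> x = y;
  zf_foundation : ∀[V] x, (∃[V] y, y ∈ x) ->
    ∃[V] y, y ∈ x /\ ~ (∃[V] z, z ∈ x /\ z ∈ y);
  zf_pairing : ∀[V] x y, ∃[V] z, ∀[V] w, w ∈ z <-> w = x \/ w = y;
  zf_union : ∀[V] x, ∃[V] y, ∀[V] z, z ∈ y <-> (∃[V] w, w ∈ x /\ z ∈ w);
  zf_powerset : ∀[V] x, ∃[V] y, ∀[V] z, z ∈ y <-> (∀[V] w, w ∈ z -> w ∈ x);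
  zf_infinity : ∃[V] x,
    (∃[V] y, y ∈ x /\ ∀[V] z, ~ z ∈ y) /\
    (∀[V] y, y ∈ x -> ∃[V] z, z ∈ x /\ ∀[V] w, w ∈ z <-> w ∈ y \/ w = y);
  zf_separation : forall (A : formula) (e : nat -> U), (forall n, V (e n)) ->
    ∀[V] x, ∃[V] y, ∀[V] z, z ∈ y <-> z ∈ x /\ sat V (scons z e) A;
  zf_replacement : forall (A : formula) (e : nat -> U), (forall n, V (e n)) ->
    (∀[V] x y z, sat V (scons x (scons y e)) A ->
                 sat V (scons x (scons z e)) A -> y = z) ->
    ∀[V] a, ∃[V] b, ∀[V] y,
      y ∈ b <-> (∃[V] x, x ∈ a /\ sat V (scons x (scons y e)) A);
  zf_choice : ∀[V] x,
    (∀[V] y, y ∈ x -> ∃[V] z, z ∈ y) ->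
    (∀[V] y z, y ∈ x -> z ∈ x -> (∃[V] w, w ∈ y /\ w ∈ z) -> y = z) ->
    ∃[V] c, ∀[V] y, y ∈ x ->
      ∃[V] z, z ∈ y /\ z ∈ c /\ ∀[V] w, w ∈ y -> w ∈ c -> w = z
}.

Definition background_model := ZFC (fun _ => True).

Definition transitive_class V := forall x y, V x -> y ∈ x -> V y.

Definition model_of_set_theory V := transitive_class V /\ ZFC V.

(** ** Pairs, relations and functions as sets (Kuratowski pairs) *)

Definition subset V X Y := ∀[V] x, x ∈ X -> x ∈ Y.

Definition is_upair V p x y := ∀[V] w, w ∈ p <-> w = x \/ w = y.

Definition is_pair V p x y :=
  ∃[V] a b, is_upair V a x x /\ is_upair V b x y /\ is_upair V p a b.

Definition is_product V p X Y :=
  ∀[V] q, q ∈ p <-> (∃[V] x y, x ∈ X /\ y ∈ Y /\ is_pair V q x y).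

(** [holds V r x y]: the pair (x, y) belongs to r. *)
Definition holds V r x y := ∃[V] p, p ∈ r /\ is_pair V p x y.

Definition is_relation V r X :=
  ∀[V] p, p ∈ r -> ∃[V] x y, x ∈ X /\ y ∈ X /\ is_pair V p x y.

(** [app V f x y]: f(x) = y;  [app2 V f x y z]: f(x, y) = z. *)
Definition app V f x y := holds V f x y.
Definition app2 V f x y z := ∃[V] p, is_pair V p x y /\ app V f p z.

Definition is_function V f X Y :=
  (∀[V] p, p ∈ f -> ∃[V] x y, x ∈ X /\ y ∈ Y /\ is_pair V p x y) /\
  (∀[V] x, x ∈ X -> ∃[V] y, app V f x y /\ ∀[V] z, app V f x z -> z = y).

Definition is_function2 V f X Y Z :=
  ∃[V] p, is_product V p X Y /\ is_function V f p Z.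

(** ** Distance monoids *)

Record monoid_data := MonoidData { car : U; plus : U; zero : U; le : U }.
Implicit Types W : monoid_data.

Definition leq V W a b := holds V (le W) a b.
Definition sum V W a b c := app2 V (plus W) a b c.
Definition pos W a := a ∈ car W /\ a <> zero W.

(** [is_inf V W P m]: m is the infimum in W of the class P of elements of W
    (in particular this infimum exists); P may be empty. *)
Definition is_inf V W (P : U -> Prop) m :=
  m ∈ car W /\ (∀[V] a, P a -> leq V W m a) /\
  (∀[V] c, c ∈ car W -> (∀[V] a, P a -> leq V W c a) -> leq V W c m).

Definition is_sup V W (P : U -> Prop) m :=
  m ∈ car W /\ (∀[V] a, P a -> leq V W a m) /\
  (∀[V] c, c ∈ car W -> (∀[V] a, P a -> leq V W a c) -> leq V W m c).

Record distance_monoid V W : Prop := {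
  dm_plus : is_function2 V (plus W) (car W) (car W) (car W);
  dm_zero : zero W ∈ car W;
  dm_le : is_relation V (le W) (car W);
  dm_comm : ∀[V] a b c, sum V W a b c -> sum V W b a c;
  dm_unit : ∀[V] a, a ∈ car W -> sum V W a (zero W) a;
  dm_assoc : ∀[V] a b c x y z,
    sum V W a b x -> sum V W x c y -> sum V W b c z -> sum V W a z y;
  dm_refl : ∀[V] a, a ∈ car W -> leq V W a a;
  dm_antisym : ∀[V] a b, leq V W a b -> leq V W b a -> a = b;
  dm_trans : ∀[V] a b c, leq V W a b -> leq V W b c -> leq V W a c;
  dm_total : ∀[V] a b, a ∈ car W -> b ∈ car W -> leq V W a b \/ leq V W b a;
  dm_zero_min : ∀[V] a, a ∈ car W -> leq V W (zero W) a;
  dm_monotone_l : ∀[V] a b c x y, leq V W a b ->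
    sum V W c a x -> sum V W c b y -> leq V W x y;
  dm_monotone_r : ∀[V] a b c x y, leq V W a b ->
    sum V W a c x -> sum V W b c y -> leq V W x y;
  dm_inf : ∀[V] b X m s, b ∈ car W -> subset V X (car W) ->
    is_inf V W (fun a => a ∈ X) m -> sum V W b m s ->
    is_inf V W (fun c => ∃[V] a, a ∈ X /\ sum V W a b c) s
}.

Definition continuous_at_zero V W :=
  is_inf V W (fun c => ∃[V] a b, pos W a /\ pos W b /\ sum V W a b c) (zero W).

Definition complete V W :=
  ∀[V] X, subset V X (car W) ->
    (∃[V] m, is_inf V W (fun a => a ∈ X) m) /\
    (∃[V] m, is_sup V W (fun a => a ∈ X) m).

(** *** Completion: the Dedekind-MacNeille cuts, i.e. the sets of lower bounds
    of sets of upper bounds, ordered by inclusion.  An element a of W is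
    identified with its principal cut {c | c <= a}. *)

Definition is_cut V W X :=
  subset V X (car W) /\
  ∀[V] c, c ∈ car W ->
    (c ∈ X <->
     ∀[V] u, u ∈ car W -> (∀[V] x, x ∈ X -> leq V W x u) -> leq V W c u).

Definition principal_cut V W a X :=
  ∀[V] c, c ∈ X <-> c ∈ car W /\ leq V W c a.

Record is_completion V W (W' : monoid_data) : Prop := {
  compl_car : ∀[V] X, X ∈ car W' <-> is_cut V W X;
  compl_zero : principal_cut V W (zero W) (zero W');
  compl_le : ∀[V] p, p ∈ le W' <->
    (∃[V] X Y, X ∈ car W' /\ Y ∈ car W' /\ subset V X Y /\ is_pair V p X Y);
  compl_plus : is_function2 V (plus W') (car W') (car W') (car W');
  compl_plusE : ∀[V] X Y Z, sum V W' X Y Z ->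
    is_inf V W' (fun T => ∃[V] a b s A B,
      a ∈ car W /\ b ∈ car W /\
      principal_cut V W a A /\ leq V W' X A /\
      principal_cut V W b B /\ leq V W' Y B /\
      sum V W a b s /\ principal_cut V W s T) Z
}.

(** ** W-metric spaces *)

Record space_data := SpaceData { points : U; dist : U }.
Implicit Types S : space_data.

Definition d V S x y u := app2 V (dist S) x y u.

Definition is_max V W a b m := (m = a \/ m = b) /\ leq V W a m /\ leq V W b m.

Record metric_space V W S : Prop := {
  ms_dist : is_function2 V (dist S) (points S) (points S) (car W);
  ms_separated : ∀[V] x y u v, x ∈ points S -> y ∈ points S ->
    d V S x y u -> d V S y x v -> (is_max V W u v (zero W) <-> x = y);
  ms_triangle : ∀[V] x y z u v w s,
    d V S x z u -> d V S x y v -> d V S y z w -> sum V W v w s -> leq V W u s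
}.

(** [f] is a non-expanding map from the space to itself. *)
Definition non_expanding V W S f :=
  is_function V f (points S) (points S) /\
  ∀[V] x y x' y' u u', app V f x x' -> app V f y y' ->
    d V S x y u -> d V S x' y' u' -> leq V W u' u.

Definition cauchy_sequence V W S p :=
  ∃[V] A,
    (∀[V] a, a ∈ A -> pos W a) /\
    is_inf V W (fun c => ∃[V] a b, a ∈ A /\ b ∈ A /\ sum V W a b c) (zero W) /\
    is_function V p A (points S) /\
    (∀[V] a b x y u s, app V p a x -> app V p b y ->
       d V S x y u -> sum V W a b s -> leq V W u s).

(** The iterated bounds below are only used for complete W, where every inner
    infimum exists. *)
Definition converges V W S p x :=
  is_sup V W (fun m => ∃[V] a, pos W a /\
    is_inf V W (fun u => ∃[V] b y, leq V W b a /\ app V p b y /\ d V S x y u) m)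
    (zero W) /\
  is_sup V W (fun m => ∃[V] a, pos W a /\
    is_inf V W (fun u => ∃[V] b y, leq V W b a /\ app V p b y /\ d V S y x u) m)
    (zero W).

Definition cauchy_complete V W S :=
  complete V W /\
  ∀[V] p, cauchy_sequence V W S p -> ∃[V] x, x ∈ points S /\ converges V W S p x.

(** ** Cauchy completion *)

(** [S'] is [S], a W-metric space, regarded as a W'-metric space, where W' is
    the completion of W, with carrier [K]. *)
Definition regarded V W S S' :=
  points S' = points S /\
  ∃[V] K, (∀[V] X, X ∈ K <-> is_cut V W X) /\
    is_function2 V (dist S') (points S) (points S) K /\
    ∀[V] x y u X, d V S x y u -> d V S' x y X -> principal_cut V W u X.

(** Distance between Cauchy sequences. *)
Definition seq_dist V W S p q s :=
  is_sup V W (fun m => ∃[V] c, pos W c /\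
    is_inf V W (fun u => ∃[V] a b x y, leq V W a c /\ leq V W b c /\
      app V p a x /\ app V q b y /\ d V S x y u) m) s.

Definition seq_equiv V W S p q :=
  seq_dist V W S p q (zero W) /\ seq_dist V W S q p (zero W).

Definition is_class V W S p X :=
  ∀[V] q, q ∈ X <-> cauchy_sequence V W S q /\ seq_equiv V W S p q.

Definition constant_sequence V W x p :=
  ∀[V] q, q ∈ p <-> (∃[V] a, pos W a /\ is_pair V q a x).

(** [T] is the space of classes of Cauchy sequences on [S]. *)
Record is_sequence_completion V W S (T : space_data) : Prop := {
  sc_points : ∀[V] X, X ∈ points T <->
    (∃[V] p, cauchy_sequence V W S p /\ is_class V W S p X);
  sc_dist : is_function2 V (dist T) (points T) (points T) (car W);
  sc_distE : ∀[V] X Y p q s, X ∈ points T -> Y ∈ points T -> p ∈ X -> q ∈ Y ->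
    d V T X Y s -> seq_dist V W S p q s
}.

(** [is_cauchy_completion V W S W' T]: the Cauchy completion of (S, W) is
    (T, W'). *)
Definition is_cauchy_completion V W S (W' : monoid_data) (T : space_data) :=
  is_completion V W W' /\
  (continuous_at_zero V W ->
     exists S' : space_data, V (points S') /\ V (dist S') /\
       regarded V W S S' /\ is_sequence_completion V W' S' T) /\
  (~ continuous_at_zero V W -> regarded V W S T).

(** [completion_embedding V W S W' T x X]: the point X of the Cauchy completion
    (T, W') is the one with which the point x of S is identified. *)
Definition completion_embedding V W S (W' : monoid_data) (T : space_data) x X :=
  x ∈ points S /\ X ∈ points T /\
  (continuous_at_zero V W ->
     ∃[V] p, constant_sequence V W' x p /\ p ∈ X) /\
  (~ continuous_at_zero V W -> X = x).

(** [g] is the non-expanding extension of [f] to the Cauchy completion. *)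
Definition is_cc_map V W S f (W' : monoid_data) (T : space_data) g :=
  non_expanding V W' T g /\
  ∀[V] x y X Y, app V f x y ->
    completion_embedding V W S W' T x X ->
    completion_embedding V W S W' T y Y -> app V g X Y.

(** ** Generalized dynamical systems *)

Record system_data := SystemData
  { sys_space : space_data; sys_map : U; sys_monoid : monoid_data }.

Definition system_in V (D : system_data) :=
  let S := sys_space D in let W := sys_monoid D in
  (V (points S) /\ V (dist S)) /\ V (sys_map D) /\
  (V (car W) /\ V (plus W) /\ V (zero W) /\ V (le W)).

Definition generalized_dynamical_system V (D : system_data) :=
  let S := sys_space D in let f := sys_map D in let W := sys_monoid D in
  distance_monoid V W /\ complete V W /\
  metric_space V W S /\ cauchy_complete V W S /\ non_expanding V W S f.

Definition has_fixed_point V (D : system_data) :=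
  ∃[V] x, x ∈ points (sys_space D) /\ app V (sys_map D) x x.

(** [D'] is (cc(M), cc(f), completion of W) computed in [V], where
    [D] = (M, f, W). *)
Definition is_relativization V (D D' : system_data) :=
  is_cauchy_completion V (sys_monoid D) (sys_space D)
                         (sys_monoid D') (sys_space D') /\
  is_cc_map V (sys_monoid D) (sys_space D) (sys_map D)
              (sys_monoid D') (sys_space D') (sys_map D').

End SetTheory.

(* Main.v *)
From Stdlib Require Import Classical.
Require Import Defs.

Set Implicit Arguments.
Unset Strict Implicit.
Unset Printing Implicit Defensive.

(** Let x be a fixed point of f0 in V0.  Every point of M0, and x in
    particular, is identified with a point X of cc(M0) computed in V1, and
    cc(f0) extends f0 along this identification; so cc(f0)(X) = X.

    The substance is that X exists, as a set of V1 ([embedding_exists]).  If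
    W0 is not continuous at 0 in V1, then cc(M0) has the same points as M0
    and X is x.  If it is continuous at 0, then X is to be the class of the
    constant sequence at x, which requires the following.

    - The constant sequence and its class are sets of V1.  Both arise by
      separation from a set of V1, hence the defining properties must be
      given by formulas.  A predicate on environments is called [definable]
      when some formula expresses it, and the closure of definable predicates
      under the connectives and the quantifiers bounded by V turns this into
      a syntactic check ([constant_sequence_exists], [class_exists]).

    - The constant sequence is Cauchy.  Its domain consists of all nonzero
      elements of the completion of W0, so this completion has to be
      continuous at 0: a cut C below all sums of nonzero cuts is below all
      sums of nonzero principal cuts, so every member of C is below all sums
      of nonzero elements of W0, and therefore is 0
      ([completion_continuous]).  The remaining condition is d(x,x) = 0.

    - The class of the sequence contains it, again by d(x,x) = 0
      ([constant_self_dist]).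

    The monoid W0 is a distance monoid in the sense of V0.  As V1 may have more
    subsets of W0, an axiom about subsets may fail in V1.  The argument in V1
    rests on axioms about elements of W0, gathered in [pointed_magma], which
    go up because V0 is transitive ([pointed_magma_up]). *)

(** * Definable predicates and separation *)

Section Definability.

Variables (U : universe) (V : U -> Prop).

(** Predicates take a whole environment, so that a formula with parameters is
    a predicate that reads the parameters at fixed indices.  Variables of the
    object language then appear as [e 0], [e 1], and so on, and the goals met
    by the closure lemmas below keep this form. *)
Definition definable (P : (nat -> U) -> Prop) : Prop :=
  exists A : formula, forall e, (forall n, V (e n)) -> (sat V e A <-> P e).

Lemma definable_mem i j : definable (fun e => e i ∈ e j).
Proof. now exists (Fmem i j). Qed.

Lemma definable_eq i j : definable (fun e => e i = e j).
Proof. now exists (Feq i j). Qed.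

Lemma definable_not P : definable P -> definable (fun e => ~ P e).
Proof.
  intros [A HA]; exists (Fnot A); intros e He; cbn.
  now rewrite (HA e He).
Qed.

Lemma definable_and P Q :
  definable P -> definable Q -> definable (fun e => P e /\ Q e).
Proof.
  intros [A HA] [B HB]; exists (Fand A B); intros e He; cbn.
  now rewrite (HA e He), (HB e He).
Qed.

Lemma definable_ext P Q :
  (forall e, P e <-> Q e) -> definable P -> definable Q.
Proof.
  intros HPQ [A HA]; exists A; intros e He.
  now rewrite (HA e He).
Qed.

Lemma definable_or P Q :
  definable P -> definable Q -> definable (fun e => P e \/ Q e).
Proof.
  intros HP HQ.
  apply (@definable_ext (fun e => ~ (~ P e /\ ~ Q e))).
  - intros e; tauto.
  - apply definable_not, definable_and; now apply definable_not.
Qed.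

Lemma definable_imp P Q :
  definable P -> definable Q -> definable (fun e => P e -> Q e).
Proof.
  intros HP HQ.
  apply (@definable_ext (fun e => ~ (P e /\ ~ Q e))).
  - intros e; tauto.
  - apply definable_not, definable_and; [|apply definable_not]; assumption.
Qed.

Lemma definable_iff P Q :
  definable P -> definable Q -> definable (fun e => P e <-> Q e).
Proof. intros HP HQ; apply definable_and; now apply definable_imp. Qed.

(** The bound variable becomes the variable of index [0], and the
    variables of the environment are shifted by one. *)
Lemma definable_all (P : U -> (nat -> U) -> Prop) :
  definable (fun e => P (e 0) (fun n => e (S n))) ->
  definable (fun e => forall x, V x -> P x e).
Proof.
  intros [A HA]; exists (Fall A); intros e He; cbn.
  assert (He' : forall x, V x -> forall n, V (scons x e n))
    by (intros x Hx [|n]; cbn; auto).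
  split; intros H x Hx; apply (HA (scons x e) (He' x Hx)), (H x Hx).
Qed.

Lemma definable_ex (P : U -> (nat -> U) -> Prop) :
  definable (fun e => P (e 0) (fun n => e (S n))) ->
  definable (fun e => exists x, V x /\ P x e).
Proof.
  intros HP.
  apply (@definable_ext (fun e => ~ forall x, V x -> ~ P x e)).
  - intros e; split.
    + intros H; apply NNPP; intros N; apply H; intros x Hx Px.
      apply N; now exists x.
    + intros (x & Hx & Px) H; exact (H x Hx Px).
  - now apply definable_not, (@definable_all (fun x e => ~ P x e)),
      definable_not.
Qed.

(** Separation for predicates written in the ambient logic: the candidate
    element is put at index [0], and the parameters at the indices after
    it. *)
Lemma separation (hZ : ZFC V) P e x :
  definable P -> (forall n, V (e n)) -> V x ->
  ∃[V] y, ∀[V] z, z ∈ y <-> z ∈ x /\ P (scons z e).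
Proof.
  intros [A HA] He Hx.
  destruct (zf_separation hZ A He Hx) as (y & Hy & H).
  exists y; split; [exact Hy|]; intros z Hz.
  rewrite (H z Hz), (HA (scons z e)); [reflexivity|now intros [|n]; cbn].
Qed.

End Definability.

Ltac solve_definable :=
  cbn;
  repeat first
    [ apply definable_mem | apply definable_eq
    | apply definable_ex; cbn | apply definable_all; cbn
    | apply definable_iff | apply definable_and | apply definable_or
    | apply definable_not | apply definable_imp ].

(** * Pairs, relations and functions in a model *)

Section Model.

Variables (U : universe) (V : U -> Prop).
Hypothesis hV : model_of_set_theory V.

Let hT : transitive_class V := proj1 hV.
Let hZ : ZFC V := proj2 hV.

Lemma pair_exists x y : V x -> V y -> ∃[V] p, is_pair V p x y.
Proof.
  intros Hx Hy.
  destruct (zf_pairing hZ Hx Hx) as (a & Ha & Da).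
  destruct (zf_pairing hZ Hx Hy) as (b & Hb & Db).
  destruct (zf_pairing hZ Ha Hb) as (p & Hp & Dp).
  exists p; split; [exact Hp|].
  exists a; split; [exact Ha|]; exists b; split; [exact Hb|]; auto.
Qed.

Lemma pair_inj p x y x' y' : V x -> V y -> V x' -> V y' ->
  is_pair V p x y -> is_pair V p x' y' -> x = x' /\ y = y'.
Proof.
  intros Hx Hy Hx' Hy' (a & Ha & b & Hb & Da & Db & Dp)
    (a' & Ha' & b' & Hb' & Da' & Db' & Dp').
  pose proof (proj1 (Dp' a Ha) (proj2 (Dp a Ha) (or_introl eq_refl))) as Ea.
  pose proof (proj1 (Dp' b Hb) (proj2 (Dp b Hb) (or_intror eq_refl))) as Eb.
  pose proof (proj1 (Dp a' Ha') (proj2 (Dp' a' Ha') (or_introl eq_refl))) as Ea'.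
  pose proof (proj1 (Dp b' Hb') (proj2 (Dp' b' Hb') (or_intror eq_refl))) as Eb'.
  assert (x ∈ a /\ x ∈ b /\ y ∈ b) by (split; [apply Da|split; apply Db]; auto).
  assert (x' ∈ a' /\ x' ∈ b' /\ y' ∈ b')
    by (split; [apply Da'|split; apply Db']; auto).
  assert (x = x').
  { destruct Ea' as [-> | ->].
    - assert (x' = x \/ x' = x) by (apply Da; tauto); intuition congruence.
    - assert (x = x' \/ x = x') by (apply Da'; subst; tauto).
      intuition congruence. }
  subst x'; split; [reflexivity|].
  assert (y ∈ b' -> y' ∈ b -> y = y').
  { intros I I'; apply (Db' y Hy) in I; apply (Db y' Hy') in I'.
    intuition congruence. }
  destruct Eb as [-> | ->]; [|tauto].
  assert (y = x) by (assert (y = x \/ y = x) by (apply Da'; tauto); tauto).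
  destruct Eb' as [-> | ->]; [|tauto].
  assert (y' = x \/ y' = x) by (apply Da; tauto).
  intuition congruence.
Qed.

(** A pair lies in the double power set of any set that contains both of its
    components; this bounds the separations below. *)
Lemma pairs_bounded X Y :
  V X -> V Y -> ∃[V] B, forall p x y, V p -> x ∈ X -> y ∈ Y ->
    is_pair V p x y -> p ∈ B.
Proof.
  intros HX HY.
  destruct (zf_pairing hZ HX HY) as (q & Hq & Dq).
  destruct (zf_union hZ Hq) as (N & HN & DN).
  destruct (zf_powerset hZ HN) as (P & HP & DP).
  destruct (zf_powerset hZ HP) as (B & HB & DB).
  exists B; split; [exact HB|].
  intros p x y Hp Hx Hy (a & Ha & b & Hb & Da & Db & Dp).
  assert (HxN : x ∈ N).
  { apply (DN x (hT HX Hx)); exists X; split; [exact HX|].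
    split; [apply (Dq X HX); now left|exact Hx]. }
  assert (HyN : y ∈ N).
  { apply (DN y (hT HY Hy)); exists Y; split; [exact HY|].
    split; [apply (Dq Y HY); now right|exact Hy]. }
  apply (DB p Hp); intros w Hw Hwp; apply (DP w Hw); intros v Hv Hvw.
  destruct (proj1 (Dp w Hw) Hwp) as [->| ->].
  - now destruct (proj1 (Da v Hv) Hvw) as [->| ->].
  - now destruct (proj1 (Db v Hv) Hvw) as [->| ->].
Qed.

Lemma function_range f X Y x y : V x -> V y ->
  is_function V f X Y -> app V f x y -> x ∈ X /\ y ∈ Y.
Proof.
  intros Hx Hy [F _] (p & Hp & Hpf & Dp).
  destruct (F p Hp Hpf) as (x' & Hx' & y' & Hy' & Hx'X & Hy'Y & Dp').
  now destruct (pair_inj Hx Hy Hx' Hy' Dp Dp') as [-> ->].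
Qed.

Lemma function2_total f X Y Z x y : x ∈ X -> y ∈ Y -> V x -> V y ->
  is_function2 V f X Y Z -> ∃[V] z, app2 V f x y z.
Proof.
  intros Hx Hy HxV HyV (P & HP & DP & F1 & F2).
  destruct (pair_exists HxV HyV) as (q & Hq & Dq).
  assert (HqP : q ∈ P).
  { apply (DP q Hq); exists x; split; [exact HxV|]; exists y; auto. }
  destruct (F2 q Hq HqP) as (z & Hz & Az & _).
  exists z; split; [exact Hz|]; exists q; auto.
Qed.

Lemma function2_range f X Y Z x y z : V z ->
  is_function2 V f X Y Z -> app2 V f x y z -> z ∈ Z.
Proof.
  intros Hz (P & HP & DP & F) (q & Hq & Dq & A).
  now destruct (function_range Hq Hz F A).
Qed.

(** The separation axiom of a metric space, applied to the pair of equal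
    points, says that max(d(x,x), d(x,x)) = 0. *)
Lemma self_distance W S x : V (points S) ->
  metric_space V W S -> x ∈ points S -> d V S x x (zero W).
Proof.
  intros HS D Ix; pose proof (hT HS Ix) as Hx.
  destruct (function2_total Ix Ix Hx Hx (ms_dist D)) as (u & Hu & E).
  destruct (proj2 (ms_separated D Hx Hx Hu Hu Ix Ix E E) eq_refl) as [M _].
  now replace (zero W) with u by (symmetry; tauto).
Qed.

End Model.

(** * Absoluteness between two models *)

Section Absoluteness.

Variables (U : universe) (V0 V1 : U -> Prop).
Hypothesis hT0 : transitive_class V0.
Hypothesis hV01 : forall x : U, V0 x -> V1 x.

Lemma upair_up p x y : V0 p -> V0 x -> V0 y ->
  is_upair V0 p x y -> is_upair V1 p x y.
Proof.
  intros Hp Hx Hy D w _; split.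
  - intros H; exact (proj1 (D w (hT0 Hp H)) H).
  - intros H; apply D; [destruct H as [->| ->]; assumption|exact H].
Qed.

Lemma pair_up p x y : V0 p -> V0 x -> V0 y ->
  is_pair V0 p x y -> is_pair V1 p x y.
Proof.
  intros Hp Hx Hy (a & Ha & b & Hb & Da & Db & Dp).
  exists a; split; [auto|]; exists b; split; [auto|].
  auto using upair_up.
Qed.

Lemma holds_up r x y : V0 r -> V0 x -> V0 y ->
  holds V0 r x y -> holds V1 r x y.
Proof.
  intros Hr Hx Hy (p & Hp & Hpr & D).
  exists p; split; [auto|]; auto using pair_up.
Qed.

Lemma app2_up f x y z : V0 f -> V0 x -> V0 y -> V0 z ->
  app2 V0 f x y z -> app2 V1 f x y z.
Proof.
  intros Hf Hx Hy Hz (p & Hp & D & A).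
  exists p; split; [auto|]; split; [now apply pair_up|].
  now apply holds_up.
Qed.

(** The components of a Kuratowski pair are elements of elements of it, so
    transitivity of the smaller model puts them there. *)
Lemma pair_down p x y : V0 p -> V1 x -> V1 y ->
  is_pair V1 p x y -> V0 x /\ V0 y /\ is_pair V0 p x y.
Proof.
  intros Hp Hx Hy (a & Ha & b & Hb & Da & Db & Dp).
  assert (Ha0 : V0 a) by (apply (hT0 Hp), Dp; auto).
  assert (Hb0 : V0 b) by (apply (hT0 Hp), Dp; auto).
  split; [apply (hT0 Ha0), Da; auto|].
  split; [apply (hT0 Hb0), Db; auto|].
  exists a; split; [exact Ha0|]; exists b; split; [exact Hb0|].
  split; [|split]; intros w Hw; auto.
Qed.

Lemma holds_down r x y : V0 r -> V1 x -> V1 y ->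
  holds V1 r x y -> V0 x /\ V0 y /\ holds V0 r x y.
Proof.
  intros Hr Hx Hy (p & Hp & Hpr & D).
  destruct (pair_down (hT0 Hr Hpr) Hx Hy D) as (Hx0 & Hy0 & D0).
  repeat split; auto; exists p; eauto.
Qed.

Lemma app2_down f x y z : V0 f -> V1 x -> V1 y -> V1 z ->
  app2 V1 f x y z -> V0 x /\ V0 y /\ V0 z /\ app2 V0 f x y z.
Proof.
  intros Hf Hx Hy Hz (p & Hp & D & A).
  destruct (holds_down Hf Hp Hz A) as (Hp0 & Hz0 & A0).
  destruct (pair_down Hp0 Hx Hy D) as (Hx0 & Hy0 & D0).
  repeat split; auto; now exists p.
Qed.

End Absoluteness.

(** * The Dedekind-MacNeille completion *)

Section Completion.

Variables (U : universe) (V : U -> Prop).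
Hypothesis hV : model_of_set_theory V.

Let hT : transitive_class V := proj1 hV.
Let hZ : ZFC V := proj2 hV.

Definition monoid_in (W : monoid_data U) : Prop :=
  V (car W) /\ V (plus W) /\ V (zero W) /\ V (le W).

(** The consequences of the axioms of a distance monoid that are used in the
    larger model.  They quantify over elements of the monoid and not over its
    subsets, of which the larger model may have more, and they hold both of
    the monoid of the smaller model and of its completion in the larger
    one. *)
Record pointed_magma (W : monoid_data U) : Prop := {
  pm_zero : zero W ∈ car W;
  pm_min : ∀[V] a, a ∈ car W -> leq V W (zero W) a;
  pm_refl : ∀[V] a, a ∈ car W -> leq V W a a;
  pm_antisym : ∀[V] a b, leq V W a b -> leq V W b a -> a = b;
  pm_sum : ∀[V] a b s, sum V W a b s -> s ∈ car W
}.

Variables W W' : monoid_data U.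
Hypotheses (hW : monoid_in W) (hW' : monoid_in W').
Hypothesis hP : pointed_magma W.
Hypothesis hC : is_completion V W W'.

Let hcar : V (car W) := proj1 hW.
Let hzero : V (zero W) := proj1 (proj2 (proj2 hW)).
Let hzero' : V (zero W') := proj1 (proj2 (proj2 hW')).

Lemma completion_leqP X Y : V X -> V Y -> X ∈ car W' -> Y ∈ car W' ->
  leq V W' X Y <-> subset V X Y.
Proof.
  intros HX HY IX IY; split.
  - intros (p & Hp & Hle & D).
    destruct (proj1 (compl_le hC Hp) Hle)
      as (X1 & HX1 & Y1 & HY1 & _ & _ & S & D1).
    now destruct (pair_inj HX HY HX1 HY1 D D1) as [-> ->].
  - intros S; destruct (pair_exists hV HX HY) as (p & Hp & D).
    exists p; split; [exact Hp|]; split; [|exact D].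
    apply (compl_le hC Hp).
    exists X; split; [exact HX|]; exists Y; auto.
Qed.

(** A cut consists of the lower bounds of a set of upper bounds, and 0 is below
    everything. *)
Lemma zero_mem_cut X : V X -> X ∈ car W' -> zero W ∈ X.
Proof.
  intros HX IX; destruct (proj1 (compl_car hC HX) IX) as [_ C].
  apply (C (zero W) hzero (pm_zero hP)).
  intros u Hu Iu _; exact (pm_min hP Hu Iu).
Qed.

Lemma principal_cut_in a A : V a -> V A -> a ∈ car W ->
  principal_cut V W a A -> A ∈ car W'.
Proof.
  intros Ha HA Ia D; apply (compl_car hC HA); split.
  - intros c Hc Ic; apply (D c Hc), Ic.
  - intros c Hc Ic; split.
    + intros IcA u Hu Iu B; exact (B c Hc IcA).
    + intros B; apply (D c Hc); split; [exact Ic|].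
      apply (B a Ha Ia); intros x Hx Ix; apply (D x Hx), Ix.
Qed.

Lemma principal_cut_exists a : V a -> ∃[V] A, principal_cut V W a A.
Proof.
  intros Ha.
  apply (separation hZ (x := car W)
    (P := fun e => holds V (e 1) (e 0) (e 2))
    (e := scons (le W) (fun n => match n with 0 => a | _ => car W end))).
  - unfold holds, is_pair, is_upair; solve_definable.
  - intros [|[|n]]; cbn; auto; exact (proj2 (proj2 (proj2 hW))).
  - exact hcar.
Qed.

Lemma principal_cut_zero A : V A -> principal_cut V W (zero W) A -> A = zero W'.
Proof.
  intros HA D; apply (zf_extensionality hZ HA hzero'); intros c Hc.
  rewrite (D c Hc); symmetry; exact (compl_zero hC Hc).
Qed.

Lemma completion_zero_in : zero W' ∈ car W'.
Proof.
  exact (principal_cut_in hzero hzero' (pm_zero hP) (compl_zero hC)).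
Qed.

Lemma completion_zero_min X : V X -> X ∈ car W' -> leq V W' (zero W') X.
Proof.
  intros HX IX; apply completion_leqP; auto using completion_zero_in.
  intros c Hc Ic; apply (compl_zero hC Hc) in Ic as [Ic L].
  rewrite (pm_antisym hP Hc hzero L (pm_min hP Hc Ic)).
  now apply zero_mem_cut.
Qed.

(** The members of the zero cut are the elements below 0, hence 0 alone, whereas
    a is a member of its own principal cut. *)
Lemma principal_cut_pos a A : V a -> V A -> pos W a ->
  principal_cut V W a A -> pos W' A.
Proof.
  intros Ha HA [Ia Na] D; split; [now apply (@principal_cut_in a)|].
  intros ->; apply Na.
  assert (I : a ∈ zero W')
    by (apply (D a Ha); split; [exact Ia|exact (pm_refl hP Ha Ia)]).
  apply (compl_zero hC Ha) in I as [_ L].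
  exact (pm_antisym hP Ha hzero L (pm_min hP Ha Ia)).
Qed.

Lemma completion_sum_in X Y Z : V Z -> sum V W' X Y Z -> Z ∈ car W'.
Proof.
  intros HZ; exact (function2_range HZ (compl_plus hC)).
Qed.

(** Given a cut C below all sums of nonzero cuts, a member c of C and nonzero
    a, b, let A, B, T be the principal cuts of a, b and a + b.  Then
    C <= A + B <= T, so c <= a + b.  As a and b vary, continuity of the
    original monoid gives c <= 0. *)
Lemma completion_continuous : continuous_at_zero V W ->
  continuous_at_zero V W'.
Proof.
  intros (_ & _ & G); split; [exact completion_zero_in|]; split.
  - intros Z HZ (X & HX & Y & HY & _ & _ & E).
    now apply completion_zero_min, (@completion_sum_in X Y).
  - intros C HC IC B.
    apply completion_leqP; auto using completion_zero_in.
    intros c Hc IcC; apply (compl_zero hC Hc).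
    assert (Ic : c ∈ car W)
      by exact (proj1 (proj1 (compl_car hC HC) IC) c Hc IcC).
    split; [exact Ic|]; apply (G c Hc Ic).
    intros s Hs (a & Ha & b & Hb & Pa & Pb & E).
    destruct (principal_cut_exists Ha) as (A & HA & DA).
    destruct (principal_cut_exists Hb) as (D & HD & DD).
    destruct (principal_cut_exists Hs) as (T & HT & DT).
    pose proof (principal_cut_pos Ha HA Pa DA) as PA.
    pose proof (principal_cut_pos Hb HD Pb DD) as PD.
    pose proof (pm_sum hP Ha Hb Hs E) as Is.
    pose proof (principal_cut_in Hs HT Is DT) as IT.
    destruct (function2_total hV (proj1 PA) (proj1 PD) HA HD
      (compl_plus hC)) as (Z & HZ & EZ).
    pose proof (completion_sum_in HZ EZ) as IZ.
    assert (LC : leq V W' C Z).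
    { apply (B Z HZ); exists A; split; [exact HA|]; exists D; auto. }
    (* The sum Z is an infimum of principal cuts of sums a' + b' with a', b'
       above A, D; take a' = a and b' = b. *)
    assert (LZ : leq V W' Z T).
    { apply (compl_plusE hC HA HD HZ EZ); [exact HT|].
      exists a; split; [exact Ha|]; exists b; split; [exact Hb|].
      exists s; split; [exact Hs|]; exists A; split; [exact HA|].
      exists D; split; [exact HD|].
      split; [apply Pa|]; split; [apply Pb|]; split; [exact DA|].
      split; [apply completion_leqP; firstorder|].
      split; [exact DD|].
      split; [apply completion_leqP; firstorder|]; auto. }
    apply completion_leqP in LC; auto; apply completion_leqP in LZ; auto.
    apply (DT c Hc), (LZ c Hc), (LC c Hc IcC).
Qed.

Lemma completion_pointed_magma : pointed_magma W'.
Proof.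
  assert (L : ∀[V] X Y, leq V W' X Y -> X ∈ car W' /\ Y ∈ car W').
  { intros X HX Y HY (p & Hp & Hle & D).
    destruct (proj1 (compl_le hC Hp) Hle)
      as (X1 & HX1 & Y1 & HY1 & I1 & J1 & _ & D1).
    now destruct (pair_inj HX HY HX1 HY1 D D1) as [-> ->]. }
  split.
  - exact completion_zero_in.
  - exact completion_zero_min.
  - now intros X HX IX; apply completion_leqP.
  - intros X HX Y HY XY YX; destruct (L X HX Y HY XY) as [IX IY].
    apply completion_leqP in XY; auto; apply completion_leqP in YX; auto.
    apply (zf_extensionality hZ HX HY); firstorder.
  - intros X HX Y HY Z HZ E; exact (completion_sum_in HZ E).
Qed.

End Completion.

(** * The monoid of the smaller model, seen in the larger one *)

Section Ascent.

Variables (U : universe) (V0 V1 : U -> Prop).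
Hypothesis hV0 : model_of_set_theory V0.
Hypothesis hV01 : forall x : U, V0 x -> V1 x.

Let hT0 : transitive_class V0 := proj1 hV0.

Lemma pointed_magma_up W : monoid_in V0 W -> distance_monoid V0 W ->
  pointed_magma V1 W.
Proof.
  intros (Hc & Hp & Hz & Hl) D.
  assert (up : ∀[V0] a b, leq V0 W a b -> leq V1 W a b).
  { intros a Ha b Hb; exact (holds_up hT0 hV01 Hl Ha Hb). }
  split.
  - exact (dm_zero D).
  - intros a _ Ia; pose proof (hT0 Hc Ia) as Ha.
    exact (up _ Hz _ Ha (dm_zero_min D Ha Ia)).
  - intros a _ Ia; pose proof (hT0 Hc Ia) as Ha.
    exact (up _ Ha _ Ha (dm_refl D Ha Ia)).
  - intros a Ha1 b Hb1 L1 L2.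
    destruct (holds_down hT0 hV01 Hl Ha1 Hb1 L1) as (Ha & Hb & M1).
    destruct (holds_down hT0 hV01 Hl Hb1 Ha1 L2) as (_ & _ & M2).
    exact (dm_antisym D Ha Hb M1 M2).
  - intros a Ha1 b Hb1 s Hs1 E1.
    destruct (app2_down hT0 hV01 Hp Ha1 Hb1 Hs1 E1) as (_ & _ & Hs & E).
    exact (function2_range Hs (dm_plus D) E).
Qed.

End Ascent.

(** * Constant sequences and their classes *)

Section ConstantSequence.

Variables (U : universe) (V : U -> Prop).
Hypothesis hV : model_of_set_theory V.

Let hT : transitive_class V := proj1 hV.
Let hZ : ZFC V := proj2 hV.

Variables (W : monoid_data U) (S : space_data U).
Hypotheses (hW : monoid_in V W) (hpoints : V (points S)) (hdist : V (dist S)).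

Let hcar : V (car W) := proj1 hW.
Let hzero : V (zero W) := proj1 (proj2 (proj2 hW)).

(** A Cauchy sequence is a set of pairs in W x S, so it is an element of the
    power set of a set that contains all these pairs. *)
Lemma cauchy_bound : ∃[V] B, ∀[V] q, cauchy_sequence V W S q -> q ∈ B.
Proof.
  destruct (pairs_bounded hV hcar hpoints) as (B & HB & DB).
  destruct (zf_powerset hZ HB) as (Q & HQ & DQ).
  exists Q; split; [exact HQ|].
  intros q Hq (A & HA & PA & _ & F & _); apply (DQ q Hq).
  intros z Hz Iz; destruct (proj1 F z Hz Iz) as (a & Ha & y & Hy & Ia & Iy & D).
  exact (DB z a y Hz (proj1 (PA a Ha Ia)) Iy D).
Qed.

Lemma class_exists p : V p -> ∃[V] X, is_class V W S p X.
Proof.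
  intros Hp; destruct cauchy_bound as (B & HB & DB).
  (* Index 0 is reserved for the candidate sequence; the components of W and
     S and the sequence p follow, in the order in which P reads them. *)
  set (e := scons (car W) (scons (plus W) (scons (zero W) (scons (le W)
              (scons (points S) (scons (dist S) (fun _ => p))))))).
  destruct hW as (H1 & H2 & H3 & H4).
  destruct (separation hZ (x := B) (e := e) (P := fun e =>
      let W := MonoidData (e 1) (e 2) (e 3) (e 4) in
      let S := SpaceData (e 5) (e 6) in
      cauchy_sequence V W S (e 0) /\ seq_equiv V W S (e 7) (e 0)))
    as (X & HX & DX).
  - unfold seq_equiv, seq_dist, cauchy_sequence, is_function, is_inf, is_sup,
      pos, sum, leq, d, app2, app, holds, is_pair, is_upair.
    solve_definable.
  - now intros [|[|[|[|[|[|n]]]]]]; cbn.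
  - exact HB.
  - exists X; split; [exact HX|]; intros q Hq; rewrite (DX q Hq).
    destruct W, S; cbn in *.
    split; [tauto|]; intros H; split; [apply (DB q Hq)|]; apply H.
Qed.

Variable x : U.
Hypothesis hx : x ∈ points S.
Let hxV : V x := hT hpoints hx.

Lemma constant_sequence_exists : ∃[V] p, constant_sequence V W x p.
Proof.
  destruct (pairs_bounded hV hcar hpoints) as (B & HB & DB).
  destruct (separation hZ (x := B)
    (e := scons (car W) (scons (zero W) (fun _ => x)))
    (P := fun e => ∃[V] a, (a ∈ e 1 /\ a <> e 2) /\ is_pair V (e 0) a (e 3)))
    as (p & Hp & Dp).
  - unfold is_pair, is_upair; solve_definable.
  - now intros [|[|n]]; cbn.
  - exact HB.
  - exists p; split; [exact Hp|]; intros q Hq; rewrite (Dp q Hq); split.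
    + now intros [_ H].
    + intros H; split; [|exact H]; destruct H as (a & Ha & [Ia _] & D).
      exact (DB q a x Hq Ia hx D).
Qed.

Variable p : U.
Hypothesis hconst : constant_sequence V W x p.

Lemma app_constant a y : V a -> V y ->
  app V p a y <-> pos W a /\ y = x.
Proof.
  intros Ha Hy; split.
  - intros (q & Hq & Iq & D).
    destruct (proj1 (hconst Hq) Iq) as (a' & Ha' & P & D').
    now destruct (pair_inj Ha Hy Ha' hxV D D') as [-> ->].
  - intros [P ->]; destruct (pair_exists hV Ha hxV) as (q & Hq & D).
    exists q; split; [exact Hq|]; split; [|exact D].
    apply (hconst Hq); exists a; auto.
Qed.

Hypothesis hP : pointed_magma V W.
Hypothesis hself : d V S x x (zero W).
Hypothesis hself_unique : ∀[V] u, d V S x x u -> u = zero W.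

(** With all of the nonzero elements as domain, the condition on the domain is
    continuity at 0, and the distances to be bounded are all d(x,x) = 0. *)
Lemma constant_cauchy : continuous_at_zero V W -> cauchy_sequence V W S p.
Proof.
  intros (_ & _ & G).
  destruct (separation hZ (x := car W) (e := fun _ => zero W)
    (P := fun e => e 0 <> e 1)) as (A & HA & DA); auto.
  { solve_definable. }
  cbn in DA; exists A; split; [exact HA|].
  split; [intros a Ha I; now apply (DA a Ha)|].
  split; [split; [exact (pm_zero hP)|split]|split; [split|]].
  - intros s Hs (a & Ha & b & Hb & _ & _ & E).
    exact (pm_min hP Hs (pm_sum hP Ha Hb Hs E)).
  - intros c Hc Ic B; apply (G c Hc Ic).
    intros s Hs (a & Ha & b & Hb & Pa & Pb & E).
    apply (B s Hs); exists a; split; [exact Ha|]; exists b; split; [exact Hb|].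
    split; [now apply DA|]; split; [now apply DA|exact E].
  - intros q Hq Iq; destruct (proj1 (hconst Hq) Iq) as (a & Ha & P & D).
    exists a; split; [exact Ha|]; exists x; split; [exact hxV|].
    split; [now apply DA|]; auto.
  - intros a Ha Ia; exists x; split; [exact hxV|].
    split; [apply app_constant; auto; split; [now apply DA|reflexivity]|].
    intros z Hz Az; now apply app_constant in Az.
  - intros a Ha b Hb y Hy z Hz u Hu s Hs Ay Az D E.
    apply app_constant in Ay as [_ ->]; auto.
    apply app_constant in Az as [_ ->]; auto.
    rewrite (hself_unique Hu D); exact (pm_min hP Hs (pm_sum hP Ha Hb Hs E)).
Qed.

(** For each nonzero c the infimum under the supremum is at most 0, since c
    itself is an index of both sequences that is at most c, and gives the
    distance d(x,x). *)
Lemma constant_self_dist : seq_dist V W S p p (zero W).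
Proof.
  split; [exact (pm_zero hP)|]; split.
  - intros m Hm (c & Hc & Pc & _ & L & _); apply (L (zero W) hzero).
    exists c; split; [exact Hc|]; exists c; split; [exact Hc|].
    exists x; split; [exact hxV|]; exists x; split; [exact hxV|].
    assert (leq V W c c) by exact (pm_refl hP Hc (proj1 Pc)).
    assert (app V p c x) by (apply app_constant; auto).
    auto.
  - intros c Hc Ic _; exact (pm_min hP Hc Ic).
Qed.

End ConstantSequence.

(** * Points of the Cauchy completion and the fixed point *)

Section Embedding.

Variables (U : universe) (V : U -> Prop).
Hypothesis hV : model_of_set_theory V.

Let hT : transitive_class V := proj1 hV.

Variables (W W' : monoid_data U) (S T : space_data U).
Hypotheses (hW : monoid_in V W) (hW' : monoid_in V W').
Hypothesis hS : V (points S).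
Hypothesis hP : pointed_magma V W.
Hypothesis hself : forall x, x ∈ points S -> d V S x x (zero W).

(** The embedding of a space in its Cauchy completion is total.  In the
    continuous case the point is the class of the constant sequence, formed in
    the space [S'] with distances in the completed monoid. *)
Lemma embedding_exists x : x ∈ points S ->
  is_cauchy_completion V W S W' T ->
  ∃[V] X, completion_embedding V W S W' T x X.
Proof.
  intros Ix (hC & Hcont & Hdisc); pose proof (hT hS Ix) as Hx.
  destruct (classic (continuous_at_zero V W)) as [C|NC].
  - destruct (Hcont C) as (S' & HS' & Hd' & R & Q).
    destruct R as (E & K & HK & DK & F & D).
    pose proof (completion_pointed_magma hV hW hW' hP hC) as hP'.
    destruct hW as (Hcar & _ & Hz & _).
    assert (Ix' : x ∈ points S') by (now rewrite E).
    assert (uniq : ∀[V] X, d V S' x x X -> X = zero W').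
    { intros X HX DX; apply (principal_cut_zero hV hW' hC HX).
      exact (D x Hx x Hx (zero W) Hz X HX (hself Ix) DX). }
    assert (self : d V S' x x (zero W')).
    { destruct (function2_total hV Ix Ix Hx Hx F) as (X & HX & DX).
      now rewrite <- (uniq X HX DX). }
    destruct (constant_sequence_exists hV hW' HS' Ix') as (p & Hp & Dp).
    destruct (class_exists hV hW' HS' Hd' Hp) as (X & HX & DX).
    pose proof (completion_continuous hV hW hW' hP hC C) as C'.
    pose proof (constant_cauchy hV hW' HS' Ix' Dp hP' uniq C') as Cp.
    pose proof (constant_self_dist hV hW' HS' Ix' Dp hP' self) as Sp.
    exists X; split; [exact HX|].
    split; [exact Ix|split; [|split]].
    + apply (sc_points Q HX); exists p; auto.
    + intros _; exists p; split; [exact Hp|]; split; [exact Dp|].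
      apply (DX p Hp); split; [exact Cp|]; now split.
    + now intros NC.
  - destruct (Hdisc NC) as [E _].
    exists x; split; [exact Hx|]; split; [exact Ix|].
    split; [now rewrite E|]; split; [now intros C|reflexivity].
Qed.

End Embedding.

Theorem proposition5p1 (U : universe) (hU : background_model U)
    (V0 V1 : U -> Prop)
    (hV0 : model_of_set_theory V0) (hV1 : model_of_set_theory V1)
    (hV01 : forall x : U, V0 x -> V1 x)
    (D0 D1 : system_data U)
    (hD0 : system_in V0 D0) (hD0_gds : generalized_dynamical_system V0 D0)
    (hD1 : system_in V1 D1) (hD1_rel : is_relativization V1 D0 D1) :
  has_fixed_point V0 D0 -> has_fixed_point V1 D1.
Proof.
  intros (x & Hx & Ix & Fx).
  destruct hD0 as ((HS & Hd) & Hf & HW).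
  destruct hD0_gds as (DM & _ & MS & _).
  destruct hD1 as (_ & _ & HW1).
  destruct hD1_rel as (CC & _ & G).
  destruct HW as (Hc & Hp & Hz & Hl).
  assert (self : forall y, y ∈ points (sys_space D0) ->
            d V1 (sys_space D0) y y (zero (sys_monoid D0))).
  { intros y Iy; pose proof (proj1 hV0 _ _ HS Iy) as Hy.
    apply (app2_up (proj1 hV0) hV01 Hd Hy Hy Hz).
    exact (self_distance hV0 HS MS Iy). }
  assert (PM : pointed_magma V1 (sys_monoid D0))
    by exact (pointed_magma_up hV0 hV01
                (conj Hc (conj Hp (conj Hz Hl))) DM).
  assert (HWV1 : monoid_in V1 (sys_monoid D0)) by (repeat split; auto).
  destruct (embedding_exists hV1 HWV1 HW1 (hV01 _ HS) PM self Ix CC)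
    as (X & HX & EX).
  exists X; split; [exact HX|].
  split; [apply EX|].
  apply (G x (hV01 _ Hx) x (hV01 _ Hx) X HX X HX); auto.
  exact (holds_up (proj1 hV0) hV01 Hf Hx Hx Fx).
Qed.
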